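(* Let $d\ge 2$ and let $\Omega\subset\mathbb{R}^d$ be compact. Let $X_1,X_2,\ldots$ be i.i.d. points in $\Omega$ with density $\varphi_P$ and $Y_1,Y_2,\ldots$ i.i.d. points in $\Omega$ with density $\varphi_D$, all independent. For each $n$, let $L^*(n)$ be the length of an optimal stacker crane tour through the pairs $(X_i,Y_i)$, $i=1,\ldots,n$, and let $L_{\mathrm{SPLICE}}(n)$ be the length of the stacker crane tour produced by the SPLICE algorithm on these pairs. Then $$\lim_{n\to\infty}\frac{L_{\mathrm{SPLICE}}(n)}{L^*(n)}=1\quad\text{almost surely.}$$
   Context: Given pickup/delivery pairs $(x_i,y_i)$, $i=1,\ldots,n$, a stacker crane tour is a closed tour through all the points $x_1,\ldots,x_n,y_1,\ldots,y_n$ in which each pickup $x_i$ is immediately followed by its delivery $y_i$; its length is the sum of the Euclidean distances along the tour. The SPLICE algorithm: (1) compute a permutation $\sigma$ of $\{1,\ldots,n\}$ minimizing $\sum_i\|x_{\sigma(i)}-y_i\|$ (optimal bipartite matching); (2) add links $x_i\to y_i$ and $y_i\to x_{\sigma(i)}$, forming $N$ disjoint directed subtours; (3) if $N>1$, order the subtours $\mathcal{S}_1,\ldots,\mathcal{S}_N$ arbitrarily, set base = prev = the index of an arbitrary delivery in $\mathcal{S}_1$, and for $k=1,\ldots,N-1$: remove link $y_{\mathrm{prev}}\to x_{\sigma(\mathrm{prev})}$, let next be the index of the pickup in $\mathcal{S}_{k+1}$ closest to $y_{\mathrm{prev}}$, add link $y_{\mathrm{prev}}\to x_{\mathrm{next}}$,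 and set prev $=\sigma^{-1}(\mathrm{next})$; finally add link $y_{\mathrm{prev}}\to x_{\sigma(\mathrm{base})}$. The densities are densities of absolutely continuous distributions. *)

(* Defs.v *)
From HB Require Import structures.
From mathcomp Require Import all_boot all_order all_algebra all_fingroup.
From mathcomp Require Import all_classical all_reals all_analysis.

Set Implicit Arguments.
Unset Strict Implicit.
Unset Printing Implicit Defensive.

Import Order.TTheory GRing.Theory Num.Theory.
Import numFieldNormedType.Exports.
Local Open Scope classical_set_scope.
Local Open Scope ring_scope.

Section Defs.
Variable R : realType.

Definition edist (d : nat) (a b : d.-tuple R) : R :=
  Num.sqrt (\sum_(i < d) (tnth a i - tnth b i) ^+ 2).

(* the corresponding row vector (used to speak of the Euclidean topology) *)
Definition tuple_row (d : nat) (t : d.-tuple R) : 'rV[R]_d :=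
  \row_(i < d) tnth t i.

(* ---------- Stacker crane tours ----------
   For n pairs (x i, y i), i < n, a stacker crane tour is determined by the
   successor map tau on pair indices: the tour is
   x_i -> y_i -> x_(tau i) -> y_(tau i) -> ..., and it is a single closed tour
   iff tau has (at most, for n = 0) one cycle. *)
Definition tour_len (d n : nat) (x y : nat -> d.-tuple R) (tau : {perm 'I_n}) : R :=
  \sum_(i < n) (edist (x i) (y i) + edist (y i) (x (tau i))).

Definition is_tour (n : nat) (tau : {perm 'I_n}) : Prop := (#|porbits tau| <= 1)%N.

Definition is_opt_tour_len (d n : nat) (x y : nat -> d.-tuple R) (L : R) : Prop :=
  (exists tau : {perm 'I_n}, is_tour tau /\ tour_len x y tau = L) /\
  (forall tau : {perm 'I_n}, is_tour tau -> L <= tour_len x y tau).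

Definition match_cost (d n : nat) (x y : nat -> d.-tuple R) (s : {perm 'I_n}) : R :=
  \sum_(i < n) edist (x (s i)) (y i).

Definition opt_matching (d n : nat) (x y : nat -> d.-tuple R) (s : {perm 'I_n}) : Prop :=
  forall s' : {perm 'I_n}, match_cost x y s <= match_cost x y s'.

(* tau is a possible successor map produced by SPLICE (all the arbitrary
   choices of the algorithm -- optimal matching sigma, order of the subtours,
   the base delivery, ties for the closest pickup -- are existentially
   quantified).  Subtours are the cycles (porbit) of sigma.
   base = index of the chosen delivery of S_1;
   nx = [next_1; ...; next_(N-1)], next_k being the chosen pickup of S_(k+1);
   prev_0 = base, prev_k = sigma^-1 next_k. *)
Definition splice_succ (d n : nat) (x y : nat -> d.-tuple R) (tau : {perm 'I_n}) : Prop :=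
  exists sigma : {perm 'I_n}, opt_matching x y sigma /\
  ( ((#|porbits sigma| <= 1)%N /\ tau = sigma) \/
    ((1 < #|porbits sigma|)%N /\
     exists (base : 'I_n) (nx : seq 'I_n),
       let prev := fun k : nat => nth base (base :: map (sigma^-1)%g nx) k in
       size nx = (#|porbits sigma|).-1 /\
       (* S_1 = cycle of base, S_(k+1) = cycle of next_k : all distinct,
          hence an ordering of all N subtours *)
       uniq (map (porbit sigma) (base :: nx)) /\
       (forall k, (k < size nx)%N -> forall j : 'I_n,
          j \in porbit sigma (nth base nx k) ->
          edist (y (prev k)) (x (nth base nx k)) <= edist (y (prev k)) (x j)) /\
       (forall k, (k < size nx)%N -> tau (prev k) = nth base nx k) /\
       tau (prev (size nx)) = sigma base /\
       (forall i : 'I_n, i \notin base :: map (sigma^-1)%g nx -> tau i = sigma i))).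

Definition is_splice_len (d n : nat) (x y : nat -> d.-tuple R) (L : R) : Prop :=
  exists tau : {perm 'I_n}, splice_succ x y tau /\ tour_len x y tau = L.

(* ---------- Lebesgue integral on R^d (iterated, Tonelli) ---------- *)
Fixpoint leb_int (n : nat) : (n.-tuple R -> \bar R) -> \bar R :=
  match n return (n.-tuple R -> \bar R) -> \bar R with
  | 0 => fun f => f [tuple]
  | m.+1 => fun f =>
      (\int[@lebesgue_measure R]_x leb_int (fun t : m.-tuple R => f (cons_tuple x t)))%E
  end.

End Defs.

Section Prob.
Variables (R : realType) (d0 : measure_display) (T : measurableType d0).

Definition has_density (P : probability T R) (dim : nat) (Z : T -> dim.-tuple R)
    (phi : dim.-tuple R -> R) : Prop :=
  measurable_fun setT Z /\ measurable_fun setT phi /\ (forall t, 0 <= phi t) /\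
  forall A : set (dim.-tuple R), measurable A ->
    P (Z @^-1` A) = leb_int (fun t => ((\1_A t : R) * phi t)%:E).

Definition mutually_independent (P : probability T R) (I : eqType) (dim : nat)
    (Z : I -> T -> dim.-tuple R) : Prop :=
  forall (s : seq I) (A : I -> set (dim.-tuple R)),
    uniq s -> (forall i, measurable (A i)) ->
    P (\big[setI/setT]_(i <- s) (Z i @^-1` A i)) =
    (\big[*%E/1%E]_(i <- s) P (Z i @^-1` A i))%E.

End Prob.

(* Main.v *)
Require Import Defs.
From HB Require Import structures.
From mathcomp Require Import all_boot all_order all_algebra all_fingroup.
From mathcomp Require Import all_classical all_reals all_analysis.
From mathcomp Require Import measurable_realfun ring lra zify.

Set Implicit Arguments.
Unset Strict Implicit.
Unset Printing Implicit Defensive.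

Import Order.TTheory GRing.Theory Num.Theory.
Import numFieldNormedType.Exports.
Local Open Scope classical_set_scope.
Local Open Scope ring_scope.

(* Every stacker crane tour costs at least sum_i |x_i - y_i| plus the optimal
   matching cost.  SPLICE alters at most N links of an optimal matching with N
   cycles, and merging these cycles one by one by transpositions gives a tour
   altering at most 2N links, so |L_SPLICE - L*| <= 2 D N, with D the diameter.

   Ties between two matchings have probability 0: given all the other points,
   a tie forces some y_i onto a branch of hyperboloid with foci x_a <> x_b,
   which is Lebesgue null for d >= 2.  By exchangeability of the x_i each
   permutation is then optimal with probability at most 1/n!.  As the sum over
   permutations of 2^(number of cycles) is (n+1)!, the mean of 2^N is at most
   n+1, and the inequality of Markov with Borel-Cantelli gives N = O(log n)
   almost surely.

   Finally L* grows linearly: for small e the events |x_i - y_i| <= e are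
   independent of probability at most 1/16, so half of the first n of them occur
   with probability at most 2^n 4^-n, and Borel-Cantelli applies again. *)

(* MathComp-Analysis has another [edist]. *)
Local Notation edist := Defs.edist.

(** * Cycles of permutations *)

Section CountingCycles.
Context {T : finType}.
Implicit Types (s : {perm T}) (A : {set T}).

Lemma porbit_fixed s x y : s x = x -> (x \in porbit s y) = (x == y).
Proof.
move=> sx; rewrite porbit_sym; apply/idP/eqP => [/porbitP[i ->]|->]; last first.
  exact: porbit_id.
by elim: i => [|i IH]; rewrite ?expg0 ?perm1// expgSr permM -IH sx.
Qed.

Lemma card_porbits_tperm_mul s x y : x \notin porbit s y ->
  #|porbits (tperm x y * s)%g|.+1 = #|porbits s|.
Proof.
have [->|xy xNy] := eqVneq x y; first by rewrite porbit_id.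
by have := porbits_mul_tperm s x y; rewrite /= xy xNy addn2 addn1 => -[].
Qed.

Lemma perm_onD1 A x s : perm_on (A :\ x) s = perm_on A s && (s x == x).
Proof.
apply/fintype.subsetP/andP => [sAx|[/fintype.subsetP sA sx] z sz].
  split; first by apply/fintype.subsetP => z /sAx; rewrite inE => /andP[].
  by apply: contraT => sx; have := sAx x sx; rewrite !inE eqxx.
by rewrite !inE (sA z sz) andbT; apply: contraNneq sz => ->.
Qed.

Lemma perm_on_tperm_mul A x y s : x \in A -> y \in A ->
  perm_on A (tperm x y * s)%g = perm_on A s.
Proof.
move=> xA yA; have xyA : tperm x y \in Sym A.
  rewrite inE; apply: fintype.subset_trans (tperm_on x y) _.
  by apply/fintype.subsetP => z; rewrite !inE => /orP[]/eqP ->.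
by have := groupMl s xyA; rewrite !inE.
Qed.

Lemma sum_perm_onD1 A x (F : {perm T} -> nat) : x \in A ->
  (\sum_(s | perm_on A s) F s =
   \sum_(y in A) \sum_(s | perm_on (A :\ x) s) F (tperm x y * s)%g)%N.
Proof.
move=> xA; rewrite (partition_big (fun s => (s^-1)%g x) (mem A)) /= => [|s sA].
  apply: eq_bigr => y yA; rewrite (reindex_inj (mulgI (tperm x y))).
  apply: eq_bigl => s; rewrite perm_onD1 perm_on_tperm_mul//; congr (_ && _).
  rewrite -(inj_eq (@perm_inj _ (tperm x y * s)%g)) permKV permM tpermR.
  by rewrite eq_sym.
by rewrite -(perm_closed _ sA) permKV.
Qed.

Lemma sum_exp_porbits_perm_on A m : (0 < m)%N ->
  (\sum_(s | perm_on A s) m ^ #|porbits s| =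
   m ^ #|~: A| * \prod_(i < #|A|) (m + i))%N.
Proof.
move=> m0; have [k Ak] : {k | #|A| = k} by exists #|A|.
rewrite Ak; elim: k A Ak => [|k IH] A Ak.
  move/cards0_eq: Ak => ->; rewrite (big_pred1 1%g) => [|s]; last first.
    apply/idP/eqP => [s0|->]; last exact: perm_on1.
    by apply: perm_on_id s0 _; rewrite cards0.
  rewrite big_ord0 muln1 finset.setC0 cardsT; congr (_ ^ _)%N.
  rewrite card_imset// => x y /eqP.
  by rewrite eq_porbit_mem porbit_fixed ?perm1// => /eqP.
have [x xA] : exists x, x \in A by apply/set0Pn; rewrite -card_gt0 Ak.
have Axk : #|A :\ x| = k by move: Ak; rewrite (cardsD1 x) xA add1n => -[].
have CAx : #|~: (A :\ x)| = #|~: A|.+1.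
  by rewrite finset.setCD finset.setUC cardsU1 !inE xA.
have merge_x y : y \in A :\ x ->
    (m * \sum_(s | perm_on (A :\ x) s) m ^ #|porbits (tperm x y * s)%g| =
     \sum_(s | perm_on (A :\ x) s) m ^ #|porbits s|)%N.
  rewrite !inE => /andP[yx _]; rewrite big_distrr /=; apply: eq_bigr => s.
  rewrite perm_onD1 -expnS => /andP[_ /eqP sx].
  by rewrite card_porbits_tperm_mul// porbit_fixed// eq_sym.
apply/eqP; rewrite -(eqn_pmul2l m0) (sum_perm_onD1 _ xA) (big_setD1 x)//=.
rewrite tperm1 mulnDr [X in (_ + X)%N]big_distrr /= (eq_bigr _ merge_x).
rewrite sum_nat_const Axk; under eq_bigr do rewrite mul1g.
by rewrite -mulnDl IH// CAx big_ord_recr expnS /=; apply/eqP; ring.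
Qed.

Lemma sum_exp_porbits m : (0 < m)%N ->
  (\sum_(s : {perm T}) m ^ #|porbits s| = \prod_(i < #|T|) (m + i))%N.
Proof.
move=> m0; have := sum_exp_porbits_perm_on [set: T]%SET m0.
rewrite finset.setCT cards0 mul1n cardsT => <-; apply: eq_bigl => s.
by apply/esym/fintype.subsetP => x; rewrite inE.
Qed.

Lemma sum_exp2_porbits : (\sum_(s : {perm T}) 2 ^ #|porbits s| = #|T|.+1`!)%N.
Proof.
by rewrite sum_exp_porbits// fact_prod big_add1 big_mkord big_ord_recl mul1n.
Qed.

End CountingCycles.

Section MergingCycles.
Context {T : finType}.
Implicit Types s t : {perm T}.

Definition perm_diff s t : {set T} := [set i | s i != t i]%SET.

Lemma perm_diffss s : perm_diff s s = finset.set0.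
Proof. by apply/setP => i; rewrite !inE eqxx. Qed.

Lemma card_perm_diff_tperm_mul t s (a b : T) :
  (#|perm_diff t s| <= #|perm_diff t (tperm a b * s)%g| + 2)%N.
Proof.
have sub : perm_diff t s \subset
    (perm_diff t (tperm a b * s)%g :|: [set a; b])%SET.
  apply/fintype.subsetP => i; rewrite !inE => ti.
  have [->|ia] := eqVneq i a; first by rewrite orbT.
  have [->|ib] := eqVneq i b; first by rewrite !orbT.
  by rewrite permM tpermD ?ti// eq_sym.
rewrite (leq_trans (subset_leq_card sub))// (leq_trans (leq_card_setU _ _))//.
by rewrite leq_add2l cards2; case: eqP.
Qed.

Lemma exists_one_cycle_near s :
  exists2 t, (#|porbits t| <= 1)%N &
    (#|perm_diff t s| <= 2 * #|porbits s|.-1)%N.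
Proof.
have [k sk] : {k | #|porbits s|.-1 = k} by exists #|porbits s|.-1.
elim: k s sk => [|k IH] s sk.
  by exists s; rewrite ?perm_diffss ?cards0// -subn_eq0 subn1 sk.
have s_gt1 : (1 < #|porbits s|)%N by rewrite ltnNge -subn_eq0 subn1 sk.
have [_ [_ [/imsetP[a _ ->] /imsetP[b _ ->] ab]]] := card_gt1P s_gt1.
rewrite eq_porbit_mem in ab.
have merged : #|porbits (tperm a b * s)%g|.-1 = k.
  by have := sk; rewrite -(card_porbits_tperm_mul ab) /= => ->.
have [t t_le1 ts_le] := IH _ merged; exists t => //.
apply: leq_trans (card_perm_diff_tperm_mul _ _ a b) _.
by rewrite sk mulnS addnC leq_add2l -merged.
Qed.

End MergingCycles.

(** * Tours and matchings *)

Section EuclideanDistance.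
Context {R : realType} {d : nat}.
Implicit Types a b : d.-tuple R.

Lemma edist_ge0 a b : 0 <= edist a b.
Proof. exact: sqrtr_ge0. Qed.

Lemma edistC a b : edist a b = edist b a.
Proof. by congr Num.sqrt; apply: eq_bigr => i _; rewrite -sqrrN opprB. Qed.

Lemma edist_sqr a b : edist a b ^+ 2 = \sum_(i < d) (tnth a i - tnth b i) ^+ 2.
Proof. by rewrite sqr_sqrtr// sumr_ge0// => i _; exact: sqr_ge0. Qed.

Lemma edist_eq0 a b : (edist a b == 0) = (a == b).
Proof.
rewrite -sqrf_eq0 edist_sqr psumr_eq0 => [|i _]; last exact: sqr_ge0.
apply/allP/eqP => [ab|-> i _]; last by rewrite /= subrr expr0n.
apply: eq_from_tnth => i; apply/eqP; rewrite -subr_eq0 -sqrf_eq0.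
exact: ab (mem_index_enum i).
Qed.

End EuclideanDistance.

Section Tours.
Context {R : realType} {d n : nat}.
Implicit Types (x y : nat -> d.-tuple R) (s t tau : {perm 'I_n}).

Lemma tour_lenE x y tau :
  tour_len x y tau = \sum_(i < n) edist (x i) (y i) + match_cost x y tau.
Proof.
rewrite /tour_len big_split; congr (_ + _).
by apply: eq_bigr => i _; rewrite edistC.
Qed.

Lemma match_cost_ge0 x y s : 0 <= match_cost x y s.
Proof. by apply: sumr_ge0 => i _; exact: edist_ge0. Qed.

Lemma match_cost_le_diff x y (D : R) s t :
    (forall i j : 'I_n, edist (x i) (y j) <= D) ->
  match_cost x y s <= match_cost x y t + D *+ #|perm_diff s t|.
Proof.
move=> xyD; rewrite -sumr_const [X in _ + X]big_mkcond -big_split /=.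
apply: ler_sum => i _; rewrite inE; case: eqP => [->|_]; first by rewrite addr0.
by rewrite (le_trans (xyD _ _))// lerDr edist_ge0.
Qed.

Lemma match_costD1 x y s (i : 'I_n) : match_cost x y s =
  edist (x (s i)) (y i) + \sum_(j < n | j != i) edist (x (s j)) (y j).
Proof. by rewrite /match_cost (bigD1 i). Qed.

Definition extend_perm s (i : nat) : nat :=
  if insub i is Some j then s j else i.

Lemma extend_permK s : {in gtn n, cancel (extend_perm s) (extend_perm s^-1%g)}.
Proof.
by move=> i i_n; rewrite /extend_perm [insub i]insubT /= valK permK.
Qed.

Lemma match_cost_extend_perm x y s t :
  match_cost (x \o extend_perm s) y t = match_cost x y (t * s)%g.
Proof. by apply: eq_bigr => i _; rewrite permM /extend_perm /= valK. Qed.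

Lemma opt_matching_extend_perm x y s :
  opt_matching (x \o extend_perm s) y (1%g : {perm 'I_n}) <->
  opt_matching x y s.
Proof.
split=> s_opt t; last by rewrite !match_cost_extend_perm mul1g; exact: s_opt.
by have := s_opt (t * s^-1)%g; rewrite !match_cost_extend_perm mul1g mulgKV.
Qed.

(* SPLICE may start from any optimal matching, hence the maximum. *)
Definition max_opt_cycles x y : nat :=
  \max_(s : {perm 'I_n} | `[< opt_matching x y s >]) #|porbits s|.

Lemma card_porbits_le_max x y s :
  opt_matching x y s -> (#|porbits s| <= max_opt_cycles x y)%N.
Proof. by move=> /asboolP; exact: leq_bigmax_cond. Qed.

Lemma max_opt_cycles_gtP x y k :
  (k < max_opt_cycles x y)%N <->
  exists2 s : {perm 'I_n}, (k < #|porbits s|)%N & opt_matching x y s.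
Proof.
split=> [|[s ks /card_porbits_le_max]]; last exact: leq_trans.
rewrite ltnNge => /negP no_bound; apply: contrapT => no_s; apply: no_bound.
apply/bigmax_leqP => s /asboolP s_opt; rewrite leqNgt; apply/negP => ks.
by apply: no_s; exists s.
Qed.

Lemma splice_succ_near x y tau : splice_succ x y tau ->
  exists2 s, opt_matching x y s & (#|perm_diff tau s| <= max_opt_cycles x y)%N.
Proof.
move=> [s [s_opt splice]]; exists s => //.
apply: leq_trans (card_porbits_le_max s_opt).
case: splice => [[_ ->]|[s1 [base [nx [sznx [_ [_ [_ [_ tauE]]]]]]]]].
  by rewrite perm_diffss cards0.
have sub : perm_diff tau s \subset base :: map (s^-1)%g nx.
  apply/fintype.subsetP => i; rewrite inE; apply: contraNT => /tauE ->.
  exact: eqxx.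
rewrite (leq_trans (subset_leq_card sub))// (leq_trans (card_size _))//=.
by rewrite size_map sznx prednK// ltnW.
Qed.

Lemma opt_tour_len_ge x y L :
  is_opt_tour_len n x y L -> \sum_(i < n) edist (x i) (y i) <= L.
Proof. by move=> [[tau [_ <-]] _]; rewrite tour_lenE lerDl match_cost_ge0. Qed.

Lemma splice_opt_dist x y (D Lopt Lspl : R) : 0 <= D ->
    (forall i j : 'I_n, edist (x i) (y j) <= D) ->
    is_opt_tour_len n x y Lopt -> is_splice_len n x y Lspl ->
  `|Lspl - Lopt| <= 2 * D * (max_opt_cycles x y)%:R.
Proof.
move=> D0 xyD [[tau_opt [tau_opt_tour <-]] opt_le] [tau_spl [spl <-]].
set N := max_opt_cycles x y.
have -> : 2 * D * N%:R = D *+ (2 * N) by rewrite mulr_natr mulr_natl mulrnA.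
have mono p q : (p <= q)%N -> D *+ p <= D *+ q by move=> pq; exact: ler_wpMn2l.
have [s s_opt spl_near] := splice_succ_near spl.
have spl_le : match_cost x y tau_spl <= match_cost x y s + D *+ (2 * N).
  apply: le_trans (match_cost_le_diff tau_spl s xyD) _.
  by rewrite lerD2l mono// (leq_trans spl_near)// leq_pmull.
have [tau tau_tour tau_near] := exists_one_cycle_near s.
have tau_le : match_cost x y tau <= match_cost x y s + D *+ (2 * N).
  apply: le_trans (match_cost_le_diff tau s xyD) _.
  rewrite lerD2l mono// (leq_trans tau_near)// leq_mul2l/=.
  by rewrite (leq_trans (leq_pred _)) ?card_porbits_le_max.
have := opt_le _ tau_tour; rewrite !tour_lenE => opt_le_tau.
have s_le_opt := s_opt tau_opt; have s_le_spl := s_opt tau_spl.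
by rewrite ler_norml; apply/andP; split; lra.
Qed.

End Tours.

Arguments max_opt_cycles {R d} n x y.

(** * Null sets of the iterated Lebesgue integral *)

Section LebNull.
Context {R : realType}.

Definition leb_null n (A : set (n.-tuple R)) : Prop :=
  forall g : n.-tuple R -> \bar R, (forall t, 0 <= g t)%E ->
    (forall t, ~ A t -> g t = 0%E) -> leb_int g = 0%E.

Lemma leb_nullS n (A B : set (n.-tuple R)) :
  A `<=` B -> leb_null B -> leb_null A.
Proof. by move=> AB B0 g g0 gA; apply: B0 => // t Bt; apply: gA => /AB. Qed.

Lemma leb_int_ge0 n (g : n.-tuple R -> \bar R) :
  (forall t, 0 <= g t)%E -> (0 <= leb_int g)%E.
Proof.
elim: n g => [|n IH] g g0 /=; first exact: g0.
by apply: integral_ge0 => x _; exact: IH.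
Qed.

Lemma integral_countable_support (F : set R) (g : R -> \bar R) : countable F ->
    (forall x, 0 <= g x)%E -> (forall x, ~ F x -> g x = 0%E) ->
  (\int[lebesgue_measure]_x g x = 0)%E.
Proof.
move=> ctF g0 gF; have mF : measurable F by exact: countable_measurable.
have mg : measurable_fun setT g.
  rewrite -(setUv F); apply/measurable_funU => //; first exact: measurableC.
  split=> [_ B _|].
    by apply: countable_measurable => //; apply: sub_countable ctF;
       apply: subset_card_le => x [].
  apply: (@eq_measurable_fun _ _ _ _ (~` F) (cst 0%E)) => [x|].
    by rewrite inE => /gF.
  exact: measurable_cst.
rewrite (@ge0_negligible_integral _ _ _ lebesgue_measure setT F)//; last first.
  exact: countable_lebesgue_measure0.
by apply: integral0_eq => x [_ /gF].
Qed.

Lemma leb_null_slices n (A : set (n.+1.-tuple R)) (F : set R) : countable F ->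
    (forall u, ~ F u -> leb_null [set t | A (cons_tuple u t)]) ->
  leb_null A.
Proof.
move=> ctF AF g g0 gA /=; apply: (integral_countable_support ctF) => u.
  by apply: leb_int_ge0 => t; exact: g0.
by move=> /AF; apply=> // t; exact: gA.
Qed.

Lemma finite_set_roots (p : {poly R}) : p != 0 -> finite_set [set u | root p u].
Proof.
move=> p0; apply: contrapT => /(infinite_set_fset (size p))[B Bp szB].
have : all (root p) (finmap.enum_fset B) by apply/allP => x /Bp.
by move=> /(max_poly_roots p0)/(_ (finmap.fset_uniq B)); rewrite ltnNge szB.
Qed.

(* polynomial in each variable separately *)
Fixpoint sep_poly (n : nat) : (n.-tuple R -> R) -> Prop :=
  match n return (n.-tuple R -> R) -> Prop with
  | 0 => fun=> True
  | m.+1 => fun f =>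
      (forall t : m.-tuple R, exists p : {poly R},
         forall u, f (cons_tuple u t) = p.[u]) /\
      (forall u, sep_poly (fun t : m.-tuple R => f (cons_tuple u t)))
  end.

Lemma eq_sep_poly n (f g : n.-tuple R -> R) :
  f =1 g -> sep_poly g -> sep_poly f.
Proof. by move=> /funext ->. Qed.

Lemma sep_polyC n (c : R) : sep_poly (fun _ : n.-tuple R => c).
Proof.
by elim: n => [//|n IH]; split=> // t; exists c%:P => u; rewrite hornerC.
Qed.

Lemma sep_polyD n (f g : n.-tuple R -> R) :
  sep_poly f -> sep_poly g -> sep_poly (fun t => f t + g t).
Proof.
elim: n f g => [//|n IH] f g [fp f_sep] [gp g_sep]; split=> [t|u]; last first.
  exact: IH (f_sep u) (g_sep u).
have [p fpE] := fp t; have [q gqE] := gp t; exists (p + q) => u.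
by rewrite hornerD fpE gqE.
Qed.

Lemma sep_polyM n (f g : n.-tuple R -> R) :
  sep_poly f -> sep_poly g -> sep_poly (fun t => f t * g t).
Proof.
elim: n f g => [//|n IH] f g [fp f_sep] [gp g_sep]; split=> [t|u]; last first.
  exact: IH (f_sep u) (g_sep u).
have [p fpE] := fp t; have [q gqE] := gp t; exists (p * q) => u.
by rewrite hornerM fpE gqE.
Qed.

Lemma sep_polyB n (f g : n.-tuple R -> R) :
  sep_poly f -> sep_poly g -> sep_poly (fun t => f t - g t).
Proof.
move=> f_sep g_sep.
apply: (@eq_sep_poly _ _ (fun t => f t + -1 * g t)) => [t|].
  by rewrite mulN1r.
by apply: sep_polyD => //; apply: sep_polyM => //; exact: sep_polyC.
Qed.

Lemma sep_poly_sum n (I : Type) (r : seq I) (f : I -> n.-tuple R -> R) :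
  (forall i, sep_poly (f i)) -> sep_poly (fun t => \sum_(i <- r) f i t).
Proof.
move=> f_sep; elim: r => [|i r IH].
  by apply: (eq_sep_poly _ (sep_polyC n 0)) => t; rewrite big_nil.
by apply: (eq_sep_poly _ (sep_polyD (f_sep i) IH)) => t; rewrite big_cons.
Qed.

Lemma sep_poly_tnth n (i : 'I_n) : sep_poly (fun t => tnth t i).
Proof.
elim: n i => [|n IH] i; first by case: i.
case: (unliftP ord0 i) => [j ->|->]; split=> [t|u].
- by exists (tnth t j)%:P => u; rewrite hornerC tnthS.
- by apply: (eq_sep_poly _ (IH j)) => t; rewrite tnthS.
- by exists 'X => u; rewrite hornerX.
- exact: sep_polyC.
Qed.

Lemma sep_poly_edist_sqr n (a : n.-tuple R) :
  sep_poly (fun t => edist a t ^+ 2).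
Proof.
apply: (eq_sep_poly (edist_sqr a)); apply: sep_poly_sum => i.
under eq_fun do rewrite expr2.
have coord_sep : sep_poly (fun t : n.-tuple R => tnth a i - tnth t i).
  by apply: sep_polyB; [exact: sep_polyC|exact: sep_poly_tnth].
exact: sep_polyM.
Qed.

(* On the line through [t0] in the first direction [f] has finitely many roots,
   and through each other point of that line passes a slice on which [f] does
   not vanish identically. *)
Lemma leb_null_sep_poly_roots n (f : n.-tuple R -> R) (t0 : n.-tuple R) :
  sep_poly f -> f t0 != 0 -> leb_null [set t | f t = 0].
Proof.
elim: n f t0 => [|n IH] f t0.
  move=> _ f0 g _ gf; apply: gf => /eqP.
  by rewrite (tuple0 t0) in f0; exact/negP.
case: (tupleP t0) => u0 {}t0 [fp f_sep] f0; have [p fpE] := fp t0.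
apply: (@leb_null_slices _ _ [set u | root p u]) => [|u /negP pu].
  apply: finite_set_countable; apply: finite_set_roots.
  by apply: contraNneq f0 => p0; rewrite fpE p0 horner0.
by apply: (IH _ t0 (f_sep u)); rewrite fpE.
Qed.

Section Euclidean.
Context {d : nat}.
Implicit Types a b t : d.-tuple R.

Lemma leb_null_point a : (0 < d)%N -> leb_null [set a].
Proof.
move=> d_gt0; apply: (@leb_nullS _ _ [set t | edist a t ^+ 2 = 0]) => [_ ->|].
  by apply/eqP; rewrite sqrf_eq0 edist_eq0.
pose b := [tuple tnth a i + 1 | i < d].
apply: (@leb_null_sep_poly_roots _ _ b); first exact: sep_poly_edist_sqr.
rewrite sqrf_eq0 edist_eq0; apply/eqP.
move=> /(congr1 (fun t => tnth t (Ordinal d_gt0)))/eqP.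
by rewrite tnth_mktuple -subr_eq0 opprD addNKr oppr_eq0 oner_eq0.
Qed.

Lemma exists_pythagorean a b : (2 <= d)%N -> a != b ->
  exists2 t, b != t & edist a t ^+ 2 = edist a b ^+ 2 + edist b t ^+ 2.
Proof.
move=> d2 ab.
have [k abk] : exists k, tnth a k != tnth b k.
  apply: contrapT => /forallNP eq_ab; move/eqP: ab; apply.
  by apply: eq_from_tnth => k; apply/eqP/negPn/negP/eq_ab.
have [j jk] : exists j : 'I_d, j != k.
  have [k0|k0] := eqVneq k (Ordinal (ltnW d2)).
    by exists (Ordinal d2); rewrite k0.
  by exists (Ordinal (ltnW d2)); rewrite eq_sym.
pose v i : R := if i == k then tnth b j - tnth a j
                else if i == j then tnth a k - tnth b k else 0.
have v_orth : \sum_i (tnth a i - tnth b i) * v i = 0.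
  rewrite (bigD1 k)//= (bigD1 j)//= big1 => [|i /andP[ik ij]]; last first.
    by rewrite /v (negbTE ik) (negbTE ij) mulr0.
  by rewrite /v eqxx (negbTE jk) eqxx; ring.
exists [tuple tnth b i + v i | i < d].
  apply/eqP => /(congr1 (fun t => tnth t j))/eqP.
  rewrite tnth_mktuple -subr_eq0 opprD.
  by rewrite addNKr oppr_eq0 /v (negbTE jk) eqxx subr_eq0 (negbTE abk).
rewrite -[RHS]subr0 -[X in _ - X](mulr0 2) -v_orth !edist_sqr -big_split /=.
rewrite mulr_sumr -sumrB.
by apply: eq_bigr => i _; rewrite tnth_mktuple; ring.
Qed.

(* Squaring twice shows that the branch of hyperboloid is contained in the zero
   set of a polynomial.  If [|a - b| = |c|] this polynomial is nonzero at any
   point [t != b] such that [t - b] is orthogonal to [a - b], otherwise it is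
   nonzero at [b]. *)
Lemma leb_null_hyperboloid a b (c : R) : (2 <= d)%N -> a != b ->
  leb_null [set t | edist a t - edist b t = c].
Proof.
move=> d2 ab; pose h t := edist a t ^+ 2 - edist b t ^+ 2 - c ^+ 2.
pose f t := h t * h t - 4 * c ^+ 2 * edist b t ^+ 2.
apply: (@leb_nullS _ _ [set t | f t = 0]) => [t /= tc|].
  by rewrite /f /h -tc; ring.
have f_sep : sep_poly f.
  have h_sep : sep_poly h.
    apply: sep_polyB (sep_polyC _ _).
    by apply: sep_polyB; exact: sep_poly_edist_sqr.
  apply: sep_polyB; first exact: sep_polyM.
  by apply: sep_polyM (sep_poly_edist_sqr b); exact: sep_polyC.
suff [t ft] : exists t, f t != 0 by exact: leb_null_sep_poly_roots f_sep ft.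
have [abc|abc] := eqVneq (edist a b ^+ 2) (c ^+ 2); last first.
  exists b; have /eqP bb : edist b b == 0 by rewrite edist_eq0.
  by rewrite /f /h bb expr0n mulr0 !subr0 mulf_neq0 ?subr_eq0.
have [t bt at_eq] := exists_pythagorean d2 ab; exists t.
rewrite /f /h at_eq -abc.
rewrite (_ : _ - _ = - (4 * edist a b ^+ 2 * edist b t ^+ 2)); last by ring.
by rewrite oppr_eq0 !mulf_neq0 ?sqrf_eq0 ?edist_eq0.
Qed.

End Euclidean.

End LebNull.

(** * Independence and laws of families *)

Section Cylinders.
Context {dS : measure_display} {S : measurableType dS} {I : choiceType}.
Context {T : pointedType}.
Implicit Types (Z : I -> T -> S) (s : seq I).

Definition cylinders Z s : set (set T) :=
  [set B | exists2 A : I -> set S, (forall k, measurable (A k)) &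
    B = \bigcap_(k in [set` s]) (Z k @^-1` A k)].

Lemma cylindersI Z s : setI_closed (cylinders Z s).
Proof.
move=> _ _ [A mA ->] [B mB ->]; exists (fun k => A k `&` B k).
  by move=> k; exact: measurableI.
by rewrite -bigcapI; apply: eq_bigcapr => k _; rewrite preimage_setI.
Qed.

Lemma cylindersT Z s : cylinders Z s setT.
Proof. by exists (fun=> setT) => //; apply/seteqP; split. Qed.

Lemma cylinders_subset Z s1 s2 :
  {subset s1 <= s2} -> cylinders Z s1 `<=` cylinders Z s2.
Proof.
move=> s12 _ [A mA ->]; exists (fun k => if k \in s1 then A k else setT).
  by move=> k; case: ifP.
apply/seteqP; split=> w Aw k /= ks; last first.
  by have := Aw k (s12 k ks); rewrite /= ks.
by case: ifP => // /Aw.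
Qed.

Lemma measurable_coord Z s k : k \in s ->
  measurable_fun setT (Z k : g_sigma_algebraType (cylinders Z s) -> S).
Proof.
move=> ks _ B mB; rewrite setTI; apply: sub_sigma_algebra.
exists (fun i => if i == k then B else setT) => [i|]; first by case: ifP.
apply/seteqP; split=> [w Bw i _ /=|w /(_ k ks) /=]; last by rewrite eqxx.
by case: eqP => // ->.
Qed.

End Cylinders.

Section Independence.
Context {R : realType} {d0 : measure_display} {T : measurableType d0}.
Variable P : probability T R.
Local Open Scope ereal_scope.

Lemma indep_g_sigma_algebra (G : set (set T)) (B : set T) :
    G `<=` measurable -> setI_closed G -> G setT -> measurable B ->
    (forall A, G A -> P (A `&` B) = P A * P B) ->
  forall A, <<s G >> A -> P (A `&` B) = P A * P B.
Proof.
move=> Gm GI GT mB GB A GA.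
have PB0 : (0 <= fine (P B))%R by rewrite fine_ge0.
have PBE : (fine (P B))%:E = P B by rewrite fineK// fin_num_measure.
have mrestrE C : (mrestr P mB C = mscale (NngNum PB0) P C) =
    (P (C `&` B) = P C * P B) by rewrite /mrestr /mscale /= PBE muleC.
rewrite -mrestrE.
apply: (g_sigma_algebra_measure_unique G Gm (fun=> setT)) => //=.
- by rewrite bigcup_const.
- by move=> C GC; rewrite mrestrE; exact: GB.
- move=> _; rewrite /mrestr setTI.
  by rewrite (le_lt_trans (probability_le1 P mB))// ltry.
Qed.

Context {dS : measure_display} {S : measurableType dS} {I : choiceType}.
Variable Z : I -> T -> S.
Hypothesis mZ : forall k, measurable_fun setT (Z k).

Lemma cylinders_measurable (s : seq I) : cylinders Z s `<=` measurable.
Proof.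
move=> _ [A mA ->]; rewrite bigcap_seq; apply: bigsetI_measurable => k _.
by rewrite -[X in measurable X]setTI; exact: mZ.
Qed.

Lemma sub_cylinders_measurable (s : seq I) :
  <<s cylinders Z s >> `<=` @measurable _ T.
Proof.
apply: smallest_sub; first exact: sigma_algebra_measurable.
exact: cylinders_measurable.
Qed.

Hypothesis indep : forall (s : seq I) (A : I -> set S),
  uniq s -> (forall i, measurable (A i)) ->
  P (\big[setI/setT]_(i <- s) (Z i @^-1` A i)) =
  \big[*%E/1]_(i <- s) P (Z i @^-1` A i).

Lemma indep_cylinders (s1 s2 : seq I) (B1 B2 : set T) : uniq (s1 ++ s2) ->
  cylinders Z s1 B1 -> cylinders Z s2 B2 -> P (B1 `&` B2) = P B1 * P B2.
Proof.
move=> us [A1 mA1 ->] [A2 mA2 ->]; rewrite !bigcap_seq.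
have := us; rewrite cat_uniq => /and3P[us1 s12 us2].
pose A k := if k \in s2 then A2 k else A1 k.
have mA k : measurable (A k) by rewrite /A; case: ifP.
have -> : \big[setI/setT]_(k <- s1) (Z k @^-1` A1 k) =
    \big[setI/setT]_(k <- s1) (Z k @^-1` A k).
  rewrite !big_seq; apply: eq_bigr => k ks1; rewrite /A ifN//.
  by apply: contra s12 => ks2; apply/hasP; exists k.
have -> : \big[setI/setT]_(k <- s2) (Z k @^-1` A2 k) =
    \big[setI/setT]_(k <- s2) (Z k @^-1` A k).
  by rewrite !big_seq; apply: eq_bigr => k ks2; rewrite /A ks2.
by rewrite -big_cat !indep// big_cat.
Qed.

Lemma indep_sigma_cylinders (s1 s2 : seq I) (A B : set T) : uniq (s1 ++ s2) ->
  <<s cylinders Z s1 >> A -> <<s cylinders Z s2 >> B ->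
  P (A `&` B) = P A * P B.
Proof.
move=> us sA sB; apply: (@indep_g_sigma_algebra (cylinders Z s1)) => //.
- exact: cylinders_measurable.
- exact: cylindersI.
- exact: cylindersT.
- exact: sub_cylinders_measurable sB.
move=> {sA}A cA; rewrite setIC muleC.
apply: (@indep_g_sigma_algebra (cylinders Z s2)) => //.
- exact: cylinders_measurable.
- exact: cylindersI.
- exact: cylindersT.
- exact: cylinders_measurable cA.
by move=> {sB}B cB; rewrite setIC muleC; exact: indep_cylinders us cA cB.
Qed.

Lemma indep_blocks (J : eqType) (block : J -> seq I) (r : seq J)
    (A : J -> set T) :
    uniq (flatten [seq block j | j <- r]) ->
    (forall j, <<s cylinders Z (block j) >> (A j)) ->
  P (\big[setI/setT]_(j <- r) A j) = \big[*%E/1]_(j <- r) P (A j).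
Proof.
move=> + sA; elim: r => [|j r IH] /= ur.
  by rewrite !big_nil probability_setT.
rewrite !big_cons -IH; last by move: ur; rewrite cat_uniq => /and3P[].
apply: (indep_sigma_cylinders ur) => //; rewrite big_seq.
apply: (@bigsetI_measurable _ (g_sigma_algebraType
  (cylinders Z (flatten [seq block j | j <- r])))) => i ir.
apply: sub_sigma_algebra2 (sA i); apply: cylinders_subset => k ki.
by apply/flatten_mapP; exists i.
Qed.

Lemma negligible_indep_xsection (s : seq I) (j : I)
    (B : set (g_sigma_algebraType (cylinders Z s) * S)) :
    uniq (rcons s j) -> measurable B ->
    (forall w, P (Z j @^-1` xsection B w) = 0) ->
  P.-negligible [set w | B (w, Z j w)].
Proof.
move=> us mB B0; pose G := g_sigma_algebraType (cylinders Z s).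
have mid : measurable_fun setT (id : T -> G).
  move=> _ A mA; rewrite setTI preimage_id.
  exact: sub_cylinders_measurable mA.
have mpair : measurable_fun setT ((fun w => (w, Z j w)) : T -> (G * S)%type).
  exact: measurable_fun_pair.
have mpB : measurable [set w | B (w, Z j w)].
  by have := mpair measurableT _ mB; rewrite setTI.
apply/negligibleP => //.
pose law_id := distribution P (mfun_Sub (mem_set mid)).
pose law_j := distribution P (mfun_Sub (mem_set (mZ j))).
pose law_pair := distribution P (mfun_Sub (mem_set mpair)).
have /(_ _ mB) : forall C, measurable C -> (law_id \x law_j) C = law_pair C.
  apply: product_measure_unique => A1 A2 mA1 mA2.
  change (P (A1 `&` (Z j @^-1` A2)) = P A1 * P (Z j @^-1` A2)).
  apply: (@indep_sigma_cylinders s [:: j]) => //.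
    by rewrite cats1.
  have := @measurable_coord _ _ _ _ Z [:: j] j (mem_head _ _) measurableT _ mA2.
  by rewrite setTI.
move=> lawE; change (law_pair B = 0); rewrite -lawE.
by rewrite /product_measure1/= integral0_eq// => w _ /=; exact: B0.
Qed.

End Independence.

Section Law.
Context {R : realType} {d0 : measure_display} {T : measurableType d0}.
Variable P : probability T R.
Context {dS : measure_display} {S : measurableType dS} {I : choiceType}.

Definition coordinate (k : I) (f : I -> S) : S := f k.

Lemma measurable_path (s : seq I) (Z : I -> T -> S) :
    (forall k, measurable_fun setT (Z k)) ->
  measurable_fun setT ((fun w k => Z k w) :
    T -> g_sigma_algebraType (cylinders coordinate s)).
Proof.
move=> mZ; apply: (@measurability _ _ _
  (g_sigma_algebraType (cylinders coordinate s)) _ _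
  (cylinders coordinate s)) => //.
move=> _ [_ [A mA ->] <-]; rewrite setTI.
by apply: (cylinders_measurable mZ); exists A.
Qed.

Lemma eq_law (s : seq I) (Z Z' : I -> T -> S) :
    (forall k, measurable_fun setT (Z k)) ->
    (forall k, measurable_fun setT (Z' k)) ->
    (forall A : I -> set S, (forall k, measurable (A k)) ->
      P (\big[setI/setT]_(k <- s) (Z k @^-1` A k)) =
      P (\big[setI/setT]_(k <- s) (Z' k @^-1` A k))) ->
  forall B : set (I -> S), <<s cylinders coordinate s >> B ->
    P ((fun w k => Z k w) @^-1` B) = P ((fun w k => Z' k w) @^-1` B).
Proof.
move=> mZ mZ' ZZ' B mB.
pose law := distribution P (mfun_Sub (mem_set (measurable_path (s := s) mZ))).
pose law' := distribution P (mfun_Sub (mem_set (measurable_path (s := s) mZ'))).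
change (law B = law' B).
apply: (@measure_unique _ R (g_sigma_algebraType (cylinders coordinate s))
  (cylinders coordinate s) (fun=> setT) erefl (@cylindersI _ _ _ _ _ _)
  _ _ law law') => //.
- by move=> _; exact: cylindersT.
- by rewrite bigcup_const.
- by move=> _ [A mA ->]; have := ZZ' A mA; rewrite -!bigcap_seq.
- by move=> _; rewrite (le_lt_trans (probability_le1 law measurableT))// ltry.
Qed.

End Law.

(** * Counting events *)

Section MeasurableComparison.
Context {R : realType} {d0 : measure_display} {T : measurableType d0}.
Implicit Types f g : T -> R.

Lemma measurable_set_ler f g : measurable_fun setT f -> measurable_fun setT g ->
  measurable [set w | f w <= g w].
Proof.
by move=> mf mg; rewrite -[X in measurable X]setTI; exact: measurable_fun_le.
Qed.

Lemma measurable_set_eqr f g : measurable_fun setT f -> measurable_fun setT g ->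
  measurable [set w | f w = g w].
Proof.
move=> mf mg; rewrite (_ : [set _ | _] =
    [set w | f w <= g w] `&` [set w | g w <= f w]).
  by apply: measurableI; exact: measurable_set_ler.
by apply/seteqP; split=> [w /= ->//|w [/= fg gf]]; exact/le_anti/andP.
Qed.

End MeasurableComparison.

Section EventCounts.
Context {R : realType} {d0 : measure_display} {T : measurableType d0}.
Variable mu : {measure set T -> \bar R}.
Local Open Scope ereal_scope.

Lemma measure_bigcup_fin_le (I : finType) (D : {pred I}) (F : I -> set T) A :
    measurable A -> (forall i, measurable (F i)) ->
    A `<=` \bigcup_(i in [set` D]) F i ->
  mu A <= \sum_(i in D) mu (F i).
Proof.
move=> mA mF AF; rewrite -big_enum fsbig_seq ?enum_uniq//=.
apply: content_sub_fsum => // w /AF[i Di Fiw].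
by exists i => //=; rewrite mem_enum.
Qed.

Lemma borel_cantelli (F : nat -> set T) (u : nat -> R) :
    (forall n, measurable (F n)) -> (forall n, mu (F n) <= (u n)%:E) ->
    cvgn (series u) ->
  {ae mu, forall w, \forall n \near \oo, ~ F n w}.
Proof.
move=> mF Fu cvg_u; exists (lim_sup_set F); split.
- by apply: bigcap_measurable => // n _; apply: bigcup_measurable => k _.
- apply: lim_sup_set_cvg0 => //.
  apply: (@le_lt_trans _ _ (\sum_(n <oo) (u n)%:E)).
    by apply: lee_nneseries => // n _; exact: Fu.
  rewrite (_ : (fun n => _) = EFin \o series u); last first.
    by apply/funext => n; rewrite sumEFin.
  by rewrite EFin_lim// ltry.
- move=> w /= notev n _; apply: contrapT => notF; apply: notev.
  by exists n => // k /= nk Fk; apply: notF; exists k.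
Qed.

Section CountGe.
Context {I : finType}.
Variable C : I -> set T.
Hypothesis mC : forall i, measurable (C i).

Lemma count_geE k : [set w | (k <= #|[set i | w \in C i]%SET|)%N] =
  \bigcup_(A in [set A : {set I} | #|A| == k]) \bigcap_(i in [set` A]) C i.
Proof.
apply/seteqP; split=> [w /= kw|w [A /eqP <- AC] /=].
  have : (0 < #|[set A : {set I} | A \subset [set i | w \in C i]%SET &
      #|A| == k]%SET|)%N by rewrite cards_draws bin_gt0.
  move=> /card_gt0P[A]; rewrite inE => /andP[/fintype.subsetP Aw Ak].
  by exists A => // i /= /Aw; rewrite !inE.
apply: subset_leq_card; apply/fintype.subsetP => i Ai.
by rewrite !inE; exact: AC.
Qed.

Lemma measurable_count_ge k :
  measurable [set w | (k <= #|[set i | w \in C i]%SET|)%N].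
Proof.
rewrite count_geE; apply: fin_bigcup_measurable => [|A _].
  exact: finite_finset.
by apply: fin_bigcap_measurable => // i _; exact: mC.
Qed.

Lemma measure_count_ge_le (p : R) k :
    (forall A : {set I}, #|A| = k ->
      mu (\bigcap_(i in [set` A]) C i) <= (p ^+ k)%:E) ->
  mu [set w | (k <= #|[set i | w \in C i]%SET|)%N] <=
  ('C(#|I|, k)%:R * p ^+ k)%:E.
Proof.
move=> Cp.
have m_inter (A : {set I}) : measurable (\bigcap_(i in [set` A]) C i).
  by apply: fin_bigcap_measurable => // i _; exact: mC.
apply: (@le_trans _ _ (\sum_(A in [set A : {set I} | #|A| == k]%SET)
    mu (\bigcap_(i in [set` A]) C i))).
  apply: measure_bigcup_fin_le => //; first exact: measurable_count_ge.
  by rewrite count_geE => w [A Ak]; exists A => //=; rewrite inE.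
apply: (@le_trans _ _
  (\sum_(A in [set A : {set I} | #|A| == k]%SET) (p ^+ k)%:E)).
  by apply: lee_sum => A; rewrite inE => /eqP; exact: Cp.
by rewrite sumEFin sumr_const card_draws mulr_natl.
Qed.

End CountGe.
End EventCounts.

Lemma measure_bigsetU_null_inter {R : realType} {d0 : measure_display}
    {T : measurableType d0} (mu : {finite_measure set T -> \bar R})
    (I : eqType) (r : seq I) (F : I -> set T) :
    uniq r -> (forall i, measurable (F i)) ->
    (forall i j, i != j -> mu (F i `&` F j) = 0%E) ->
  mu (\big[setU/set0]_(i <- r) F i) = (\sum_(i <- r) mu (F i))%E.
Proof.
move=> + mF F0; elim: r => [|i r IH]; first by rewrite !big_nil measure0.
rewrite cons_uniq => /andP[ir ur]; rewrite !big_cons.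
have mr : measurable (\big[setU/set0]_(j <- r) F j).
  exact: bigsetU_measurable.
rewrite -IH// measureUfinl//; last first.
  by rewrite ltey_eq fin_num_measure.
rewrite [X in (_ - X)%E](_ : _ = 0%E) ?sube0//.
rewrite big_distrr /= big_seq; apply/negligibleP.
  by apply: bigsetU_measurable => j _; exact: measurableI.
elim/big_ind: _ => [|A B|j jr]; [exact: negligible_set0|exact: negligibleU|].
apply/negligibleP; first exact: measurableI.
by apply: F0; apply: contraNneq ir => ->.
Qed.

Lemma bin_leq_exp2 n k : ('C(n, k) <= 2 ^ n)%N.
Proof.
elim: n k => [|n IH] [|k]//; first by rewrite bin0 expn_gt0.
by rewrite binS expnS mul2n -addnn leq_add.
Qed.

Section LinearGrowth.
Context {R : realType} {d0 : measure_display} {T : measurableType d0}.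
Variable P : probability T R.
Variable f : nat -> T -> R.
Hypothesis mf : forall i, measurable_fun setT (f i).
Hypothesis f_ge0 : forall i w, 0 <= f i w.
Let sublevel e i := [set w | f i w <= e].
Hypothesis f_indep : forall e (r : seq nat), uniq r ->
  P (\big[setI/setT]_(i <- r) sublevel e i) =
  (\big[*%E/1]_(i <- r) P (sublevel e i))%E.
Hypothesis f_ident : forall e i, P (sublevel e i) = P (sublevel e 0).
Hypothesis f_gt0 : P (sublevel 0 0) = 0%E.

Let m_sublevel e i : measurable (sublevel e i).
Proof. exact: measurable_set_ler. Qed.

Lemma exists_prob_sublevel_lt (eps : R) : 0 < eps ->
  exists2 e, 0 < e & (P (sublevel e 0) < eps%:E)%E.
Proof.
move=> eps0; pose f0 : {RV P >-> R} := mfun_Sub (mem_set (mf 0)).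
have cdf_f0 e : cdf f0 e = P (sublevel e 0).
  by rewrite /cdf /distribution /pushforward /=; congr (P _);
     apply/seteqP; split=> w /=; rewrite in_itv.
have := @cdf_right_continuous _ _ _ _ f0 0.
rewrite cdf_f0 f_gt0 => /fine_cvgP[fin_cdf] /cvgrPdist_lt/(_ _ eps0) near_eps.
near (0 : R)^'+ => e; exists e => //.
rewrite -cdf_f0 -[ltLHS]fineK; last by near: e.
have : `|0 - fine (cdf f0 e)| < eps by near: e.
by rewrite sub0r normrN ger0_norm ?fine_ge0.
Unshelve. all: by end_near.
Qed.

Lemma prob_sublevel_inter e p (r : seq nat) : (P (sublevel e 0) <= p%:E)%E ->
  uniq r -> (P (\big[setI/setT]_(i <- r) sublevel e i) <= (p ^+ size r)%:E)%E.
Proof.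
move=> ep ur; rewrite f_indep//.
elim: r {ur} => [|i r IH]; first by rewrite big_nil.
by rewrite big_cons exprS EFinM f_ident lee_pmul//; apply: prode_ge0.
Qed.

Let many_small e n := [set w | (uphalf n <=
  #|[set i : 'I_n | w \in sublevel e i]%SET|)%N].

Lemma prob_many_small_le e n : (P (sublevel e 0) <= (16^-1)%:E)%E ->
  (P (many_small e n) <= (2^-1 ^+ n)%:E)%E.
Proof.
move=> e16; have e4 : (P (sublevel e 0) <= (4^-1 ^+ 2)%:E)%E.
  by rewrite (le_trans e16)// lee_fin expr2; lra.
apply: (@le_trans _ _ ('C(#|'I_n|, uphalf n)%:R * (4^-1 ^+ 2) ^+ uphalf n)%:E).
  apply: measure_count_ge_le => [i|A <-]; first exact: m_sublevel.
  have uA : uniq (map val (enum A)).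
    by rewrite map_inj_uniq ?enum_uniq//; exact: val_inj.
  have -> : \bigcap_(i in [set` A]) sublevel e i =
      \big[setI/setT]_(i <- map val (enum A)) sublevel e i.
    rewrite big_map -bigcap_seq (_ : [set` enum A] = [set` A])//.
    by apply/seteqP; split=> i /=; rewrite mem_enum.
  by have := prob_sublevel_inter e4 uA; rewrite size_map -cardE.
rewrite lee_fin card_ord -exprM mul2n.
apply: (@le_trans _ _ ((2 ^ n)%:R * 4^-1 ^+ n)).
  apply: ler_pM; rewrite ?exprn_ge0 ?ler_nat ?bin_leq_exp2//.
  by apply: ler_wiXn2l; rewrite ?invf_le1 ?ler1n// -leq_uphalf_double.
rewrite natrX -exprMn (_ : 2%:R * 4^-1 = 2^-1)//; by field.
Qed.

Lemma ae_sum_linear_growth :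
  exists2 c, 0 < c &
    {ae P, forall w, \forall n \near \oo, c * n%:R <= \sum_(i < n) f i w}.
Proof.
have p_gt0 : 0 < 16^-1 :> R by rewrite invr_gt0.
have [e e0 /ltW e16] := exists_prob_sublevel_lt p_gt0.
exists (e / 2); first by rewrite divr_gt0.
have : {ae P, forall w, \forall n \near \oo, ~ many_small e n w}.
  apply: (@borel_cantelli _ _ _ _ _ (GRing.exp 2^-1)) => [n|n|].
  - exact: measurable_count_ge.
  - exact: prob_many_small_le.
  - rewrite exprn_geometric; apply: is_cvg_geometric_series.
    by rewrite ger0_norm ?invr_ge0// invf_lt1 ?ltr1n.
apply: filterS => w; apply: filterS => n /negP; rewrite -ltnNge.
set A := finset _ => few_small.
apply: (@le_trans _ _ (\sum_(i in ~: A) e)).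
  rewrite sumr_const -[leRHS]mulr_natr -mulrA ler_wpM2l ?(ltW e0)//.
  rewrite ler_pdivrMl// -natrM ler_nat.
  by have := cardsC A; rewrite card_ord; lia.
rewrite big_mkcond; apply: ler_sum => i _; case: ifPn => // iA.
rewrite leNgt; apply/negP => /ltW fi_le; move: iA; rewrite !inE => /negP; apply.
by rewrite inE.
Qed.

End LinearGrowth.

(** * Series and logarithms *)

Section SeriesAndLogarithms.
Context {R : realType}.

(* The terms are bounded by [1 / ((n + 1) * (n + 2))], which telescopes. *)
Lemma is_cvg_series_succ_div_cube :
  cvgn (series (fun n => n.+1%:R / n.+2%:R ^+ 3 : R)).
Proof.
pose v : nat -> R := telescope (fun n => - harmonic n).
have u_ge0 n : 0 <= n.+1%:R / n.+2%:R ^+ 3 :> R by rewrite divr_ge0 ?exprn_ge0.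
have u_le_v n : n.+1%:R / n.+2%:R ^+ 3 <= v n.
  have n_ge0 : 0 <= n%:R :> R by [].
  rewrite /v /telescope /harmonic /= opprK addrC.
  rewrite -[n.+2%:R]natr1 -[n.+1%:R]natr1.
  rewrite -subr_ge0 [leRHS](_ : _ = (2 * n%:R + 3) /
    ((n%:R + 1) * (n%:R + 1 + 1) ^+ 3)); last by field; lra.
  by rewrite divr_ge0 ?mulr_ge0 ?exprn_ge0//; lra.
apply: (series_le_cvg u_ge0 _ u_le_v) => [n|]; first exact: le_trans (u_le_v n).
rewrite /v telescopeK; apply: is_cvgB; last exact: is_cvg_cst.
by apply: is_cvgN; apply/cvg_ex; exists 0; exact: cvg_harmonic.
Qed.

Lemma ln_div_le_sqrt (x : R) : 0 < x -> ln x / x <= 2 * Num.sqrt x^-1.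
Proof.
move=> x0; rewrite sqrtrV ?(ltW x0)//.
have : 0 < Num.sqrt x by rewrite sqrtr_gt0.
have xE : x = Num.sqrt x ^+ 2 by rewrite sqr_sqrtr ?ltW.
move: (Num.sqrt x) xE => s {x x0}-> s0.
rewrite lnXn// ler_pdivrMr ?exprn_gt0// -[leLHS]mulr_natl.
rewrite -mulrA expr2 mulKf ?gt_eqF//.
by rewrite ler_pM2l// ltW ?ln_sublinear.
Qed.

Lemma cvg_ln_div_nat : ln n%:R / n%:R @[n --> \oo] --> (0 : R).
Proof.
have cvg_sqrt : 2 * Num.sqrt n%:R^-1 @[n --> \oo] --> (0 : R).
  rewrite -(mulr0 2) -(sqrtr0 R); apply: cvgMr; apply: continuous_cvg.
    exact: sqrt_continuous.
  by rewrite -cvg_shiftS; exact: cvg_harmonic.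
apply: squeeze_cvgr (cvg_cst 0) cvg_sqrt; near=> n.
have n0 : 0 < n%:R :> R by rewrite ltr0n; near: n; exact: nbhs_infty_gt.
by rewrite ln_div_le_sqrt// divr_ge0 ?ler0n// ln_ge0// ler1n -(ltr0n R).
Unshelve. all: by end_near.
Qed.

Lemma trunc_log_le_ln p m : (1 < p)%N -> (0 < m)%N ->
  (trunc_log p m)%:R <= ln m%:R / ln p%:R :> R.
Proof.
move=> p1 m0; have lnp : 0 < ln (p%:R : R) by rewrite ln_gt0// ltr1n.
have p0 := ltnW p1; rewrite ler_pdivlMr// mulr_natl -lnXn ?ltr0n//.
by rewrite ler_ln ?posrE ?exprn_gt0 ?ltr0n// -natrX ler_nat trunc_logP.
Qed.

Lemma cvg_trunc_logX_div p k : (1 < p)%N ->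
  (trunc_log p (n ^ k))%:R / n%:R @[n --> \oo] --> (0 : R).
Proof.
move=> p1.
have cvg_ln : k%:R / ln p%:R * (ln n%:R / n%:R) @[n --> \oo] --> (0 : R).
  by rewrite -(mulr0 (k%:R / ln p%:R)); apply: cvgMr; exact: cvg_ln_div_nat.
apply: squeeze_cvgr (cvg_cst 0) cvg_ln; near=> n.
have n0 : (0 < n)%N by near: n; exact: nbhs_infty_gt.
rewrite divr_ge0//= mulrA ler_pM2r ?invr_gt0 ?ltr0n//.
have nk0 : (0 < n ^ k)%N by rewrite expn_gt0 n0.
apply: le_trans (trunc_log_le_ln p1 nk0) _.
by rewrite natrX lnXn ?ltr0n// -[ln _ *+ k]mulr_natl mulrAC.
Unshelve. all: by end_near.
Qed.

End SeriesAndLogarithms.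

(** * Independent samples with densities *)

Section EuclideanMeasurability.
Context {R : realType} {d : nat} {d0 : measure_display} {T : measurableType d0}.

Lemma measurable_fun_edist (f g : T -> d.-tuple R) :
  measurable_fun setT f -> measurable_fun setT g ->
  measurable_fun setT (fun w => edist (f w) (g w)).
Proof.
move=> mf mg; rewrite /edist.
apply: (measurableT_comp (f := @Num.sqrt R)).
  exact: continuous_measurable_fun (@sqrt_continuous R).
apply: measurable_sum => i; apply: measurable_funX; apply: measurable_funB.
- exact: (measurableT_comp (measurable_tnth i) mf).
- exact: (measurableT_comp (measurable_tnth i) mg).
Qed.

Lemma measurable_opt_matching n (x y : nat -> T -> d.-tuple R)
    (s : {perm 'I_n}) :
  (forall i : 'I_n, measurable_fun setT (x i)) ->
  (forall i : 'I_n, measurable_fun setT (y i)) ->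
  measurable [set w | opt_matching (x^~ w) (y^~ w) s].
Proof.
move=> mx my; have m_cost (t : {perm 'I_n}) :
    measurable_fun setT (fun w => match_cost (x^~ w) (y^~ w) t).
  by apply: measurable_sum => i; exact: measurable_fun_edist.
rewrite (_ : [set _ | _] = \bigcap_(t in [set: {perm 'I_n}])
  [set w | match_cost (x^~ w) (y^~ w) s <= match_cost (x^~ w) (y^~ w) t]).
  apply: fin_bigcap_measurable => [|t _]; first exact: finite_finset.
  exact: measurable_set_ler.
by apply/seteqP; split=> [w s_opt t _|w s_opt t]; exact: s_opt.
Qed.

End EuclideanMeasurability.

Section Density.
Context {R : realType} {d : nat} {d0 : measure_display} {T : measurableType d0}.
Context {P : probability T R} {V : T -> d.-tuple R} {phi : d.-tuple R -> R}.
Hypothesis hV : has_density P V phi.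

Lemma has_density_measurable : measurable_fun setT V.
Proof. by have [] := hV. Qed.

Lemma has_density_null (A : set (d.-tuple R)) :
  measurable A -> leb_null A -> P (V @^-1` A) = 0%E.
Proof.
move=> mA A0; have [_ [_ [phi_ge0 ->//]]] := hV; apply: A0 => t.
  by rewrite lee_fin mulr_ge0.
by move=> At; rewrite indicE memNset// mul0r.
Qed.

End Density.

Section IndependentDensities.
Context {R : realType} {d : nat} {d0 : measure_display} {T : measurableType d0}.
Context {P : probability T R} {I : choiceType}.
Variables (Z : I -> T -> d.-tuple R) (phi : I -> d.-tuple R -> R).
Hypothesis hZ : forall k, has_density P (Z k) (phi k).
Hypothesis indepZ : mutually_independent P Z.

Let mZ k : measurable_fun setT (Z k).
Proof. exact: has_density_measurable (hZ k). Qed.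

Lemma negligible_leb_null_xsection (s : seq I) (j : I)
    (B : set (g_sigma_algebraType (cylinders Z s) * d.-tuple R)) :
    uniq (rcons s j) -> measurable B -> (forall w, leb_null (xsection B w)) ->
  P.-negligible [set w | B (w, Z j w)].
Proof.
move=> us mB B0.
apply: (negligible_indep_xsection mZ indepZ us mB) => w.
by apply: (has_density_null (hZ j)) => //; exact: measurable_xsection.
Qed.

Lemma negligible_coincidence (k j : I) : (0 < d)%N -> k != j ->
  P.-negligible [set w | edist (Z k w) (Z j w) = 0].
Proof.
move=> d_gt0 kj.
pose B := [set p : g_sigma_algebraType (cylinders Z [:: k]) * d.-tuple R |
  edist (Z k p.1) p.2 = 0].
apply: (@negligible_leb_null_xsection [:: k] _ B); first by rewrite /= inE kj.
  apply: measurable_set_eqr => //; apply: measurable_fun_edist => //.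
  by apply: measurableT_comp => //; apply: measurable_coord; rewrite inE.
move=> w; apply: leb_nullS _ (leb_null_point (a := Z k w) d_gt0) => t.
by rewrite /xsection /= inE => /eqP; rewrite edist_eq0 => /eqP.
Qed.

Lemma eq_law_reindex (s : seq I) (f g : I -> I) :
    uniq s -> {in s, cancel f g} -> (forall k, phi (f k) = phi k) ->
  forall B : set (I -> d.-tuple R), <<s cylinders coordinate s >> B ->
    P ((fun w k => Z (f k) w) @^-1` B) = P ((fun w k => Z k w) @^-1` B).
Proof.
move=> us fK phif; apply: eq_law => [k|k|A mA]; [exact: mZ|exact: mZ|].
have -> : \big[setI/setT]_(k <- s) (Z (f k) @^-1` A k) =
    \big[setI/setT]_(k <- map f s) (Z k @^-1` A (g k)).
  by rewrite big_map !big_seq; apply: eq_bigr => k ks; rewrite fK.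
rewrite !indepZ//; last by rewrite map_inj_in_uniq//; exact: can_in_inj fK.
rewrite big_map !big_seq; apply: eq_bigr => k ks; rewrite fK//.
have [_ [_ [_ ->//]]] := hZ (f k); have [_ [_ [_ ->//]]] := hZ k.
by rewrite phif.
Qed.

End IndependentDensities.

(** * Random pickups and deliveries *)

Section SumSeq.
Context {A B : eqType}.
Implicit Types (p : seq A) (q : seq B).

Definition sum_seq p q : seq (A + B) := map inl p ++ map inr q.

Lemma mem_sum_seql p q a : (inl a \in sum_seq p q) = (a \in p).
Proof.
rewrite mem_cat mem_map => [|? ? []//].
by rewrite (_ : (_ \in map inr q) = false) ?orbF//; apply/mapP => -[].
Qed.

Lemma mem_sum_seqr p q b : (inr b \in sum_seq p q) = (b \in q).
Proof.
rewrite mem_cat orbC mem_map => [|? ? []//].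
by rewrite (_ : (_ \in map inl p) = false) ?orbF//; apply/mapP => -[].
Qed.

Lemma uniq_sum_seq p q : uniq (sum_seq p q) = uniq p && uniq q.
Proof.
rewrite cat_uniq !map_inj_uniq => [|? ? []//|? ? []//]; congr (_ && _).
by rewrite (_ : has _ _ = false)//; apply/hasP => -[_ /mapP[b _ ->] /mapP[]].
Qed.

End SumSeq.

Section PickupsAndDeliveries.
Context {R : realType} {d : nat} {d0 : measure_display} {T : measurableType d0}.
Context {P : probability T R}.
Variables (X Y : nat -> T -> d.-tuple R) (phiP phiD : d.-tuple R -> R).
Hypotheses (d_ge2 : (2 <= d)%N) (hX : forall i, has_density P (X i) phiP)
  (hY : forall i, has_density P (Y i) phiD).
Let Z (k : nat + nat) : T -> d.-tuple R :=
  match k with inl i => X i | inr i => Y i end.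
Hypothesis indepZ : mutually_independent P Z.

Let phi (k : nat + nat) : d.-tuple R -> R := if k is inl _ then phiP else phiD.

Let hZ k : has_density P (Z k) (phi k).
Proof. by case: k => i; [exact: hX|exact: hY]. Qed.

Let mX i : measurable_fun setT (X i).
Proof. exact: has_density_measurable (hX i). Qed.

Let mY i : measurable_fun setT (Y i).
Proof. exact: has_density_measurable (hY i). Qed.

Section Ties.
Variables (n : nat) (i : 'I_n).

Definition other_points : seq (nat + nat) :=
  sum_seq (iota 0 n) [seq j <- iota 0 n | j != i :> nat].

Lemma uniq_other_points : uniq (rcons other_points (inr (i : nat))).
Proof.
rewrite rcons_uniq uniq_sum_seq mem_sum_seqr mem_filter eqxx.
by rewrite filter_uniq iota_uniq.
Qed.

Let G := g_sigma_algebraType (cylinders Z other_points).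

Let mXG (j : 'I_n) : measurable_fun setT (X j : G -> _).
Proof.
apply: (@measurable_coord _ _ _ _ Z other_points (inl (j : nat))).
by rewrite mem_sum_seql mem_iota ltn_ord.
Qed.

Let mYG (j : 'I_n) : j != i -> measurable_fun setT (Y j : G -> _).
Proof.
move=> ji; apply: (@measurable_coord _ _ _ _ Z other_points (inr (j : nat))).
by rewrite mem_sum_seqr mem_filter ji mem_iota ltn_ord.
Qed.

Let other_cost (s : {perm 'I_n}) (w : G) : R :=
  \sum_(j < n | j != i) edist (X (s j) w) (Y j w).

Let m_other_cost s : measurable_fun setT (other_cost s).
Proof.
rewrite /other_cost; under eq_fun do rewrite big_mkcond.
apply: measurable_sum => j; case: (boolP (j != i)) => // ji.
by apply: measurable_fun_edist => //; exact: mYG.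
Qed.

(* Coincident foci are removed, as all positions of [Y i] could then be ties. *)
Let tie_positions (s t : {perm 'I_n}) : set (G * d.-tuple R) :=
  [set p | edist (X (s i) p.1) p.2 - edist (X (t i) p.1) p.2 =
           other_cost t p.1 - other_cost s p.1] `&`
  ~` [set p | edist (X (s i) p.1) (X (t i) p.1) = 0].

Let measurable_tie_positions s t : measurable (tie_positions s t).
Proof.
have mX1 (j : 'I_n) : measurable_fun setT (fun p : G * d.-tuple R => X j p.1).
  exact: (measurableT_comp (mXG j)).
have m_other1 u :
    measurable_fun setT (fun p : G * d.-tuple R => other_cost u p.1).
  exact: (measurableT_comp (m_other_cost u)).
apply: measurableI; [|apply: measurableC]; apply: measurable_set_eqr => //.
- by apply: measurable_funB; exact: measurable_fun_edist.
- exact: measurable_funB.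
- exact: measurable_fun_edist.
Qed.

Let leb_null_tie_positions s t w : leb_null (xsection (tie_positions s t) w).
Proof.
have [same_pickup|] := eqVneq (edist (X (s i) w) (X (t i) w)) 0.
  apply: leb_nullS _ (leb_null_point (a := Y i w) (ltnW d_ge2)) => y.
  by rewrite /xsection /= inE => -[_ /(_ same_pickup)[]].
rewrite edist_eq0 => distinct.
apply: leb_nullS _ (leb_null_hyperboloid
  (c := other_cost t w - other_cost s w) d_ge2 distinct) => y.
by rewrite /xsection /= inE => -[].
Qed.

Lemma negligible_match_cost_tie_at (s t : {perm 'I_n}) : s i != t i ->
  P.-negligible
    [set w | match_cost (X^~ w) (Y^~ w) s = match_cost (X^~ w) (Y^~ w) t].
Proof.
move=> sti.
have null_tie : P.-negligible [set w | tie_positions s t (w, Y i w)].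
  exact: (negligible_leb_null_xsection hZ indepZ uniq_other_points).
have null_same : P.-negligible [set w | edist (X (s i) w) (X (t i) w) = 0].
  exact: (negligible_coincidence hZ indepZ (k := inl (s i : nat))
    (j := inl (t i : nat)) (ltnW d_ge2)).
apply: negligibleS (negligibleU null_tie null_same) => w /= tie.
have [same_pickup|distinct] := pselect (edist (X (s i) w) (X (t i) w) = 0).
  by right.
left; split=> //=; move: tie.
by rewrite !(match_costD1 _ _ _ i) /other_cost; lra.
Qed.

End Ties.

Lemma negligible_match_cost_tie n (s t : {perm 'I_n}) : s != t ->
  P.-negligible
    [set w | match_cost (X^~ w) (Y^~ w) s = match_cost (X^~ w) (Y^~ w) t].
Proof.
move=> st; have [i sti] : exists i, s i != t i.
  apply: contrapT => /forallNP eq_st; move/eqP: st; apply; apply/permP => i.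
  exact/eqP/negPn/negP/eq_st.
exact: negligible_match_cost_tie_at sti.
Qed.

Let opt_event n (s : {perm 'I_n}) := [set w | opt_matching (X^~ w) (Y^~ w) s].

Let m_opt n (s : {perm 'I_n}) : measurable (opt_event s).
Proof. exact: measurable_opt_matching. Qed.

Lemma prob_opt_matching_eq n (s : {perm 'I_n}) :
  P (opt_event s) = P (opt_event (1%g : {perm 'I_n})).
Proof.
pose points := sum_seq (iota 0 n) (iota 0 n).
pose relabel (u : {perm 'I_n}) (k : nat + nat) : nat + nat :=
  match k with inl i => inl (extend_perm u i) | inr i => inr i end.
have relabelK : {in points, cancel (relabel s) (relabel s^-1%g)}.
  move=> [i|i //]; rewrite mem_sum_seql mem_iota => i_n /=.
  by rewrite extend_permK.
pose B := [set h : nat + nat -> d.-tuple R |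
  opt_matching (h \o inl) (h \o inr) (1%g : {perm 'I_n})].
have mB : <<s cylinders coordinate points >> B.
  apply: (@measurable_opt_matching R d _
    (g_sigma_algebraType (cylinders (@coordinate _ (d.-tuple R) _) points)) n
    (fun i => coordinate (inl i)) (fun i => coordinate (inr i))) => i.
  - by apply: measurable_coord; rewrite mem_sum_seql mem_iota ltn_ord.
  - by apply: measurable_coord; rewrite mem_sum_seqr mem_iota ltn_ord.
have <- : (fun w k => Z (relabel s k) w) @^-1` B = opt_event s.
  apply/seteqP; split=> w; first exact: (opt_matching_extend_perm _ _ s).1.
  exact: (opt_matching_extend_perm _ _ s).2.
rewrite (eq_law_reindex hZ indepZ _ relabelK)//; last by case.
by rewrite uniq_sum_seq iota_uniq.
Qed.

Lemma prob_opt_matching_le n (s : {perm 'I_n}) :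
  (P (opt_event s) <= (n`!%:R^-1)%:E)%E.
Proof.
have : (\sum_(u : {perm 'I_n}) P (opt_event u) <= 1)%E.
  rewrite -measure_bigsetU_null_inter//.
  - apply: probability_le1; apply: bigsetU_measurable => u _.
    exact: (m_opt u).
  - exact: index_enum_uniq.
  - move=> u v uv; apply: measure_negligible.
      by apply: measurableI; exact: m_opt.
    apply: negligibleS (negligible_match_cost_tie uv) => w [/= u_opt v_opt].
    by apply/le_anti/andP.
rewrite (eq_bigr (fun=> P (opt_event s))) => [|u _]; last first.
  by rewrite prob_opt_matching_eq [RHS]prob_opt_matching_eq.
rewrite -[P (opt_event s)]fineK ?fin_num_measure//.
rewrite sumEFin !lee_fin sumr_const card_Sn => sum_le1.
by rewrite -[leRHS]mul1r ler_pdivlMr ?ltr0n ?fact_gt0// mulr_natr.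
Qed.

Let many_cycles n k := [set w | (k < max_opt_cycles n (X^~ w) (Y^~ w))%N].

Let many_cyclesE n k : many_cycles n k =
  \bigcup_(s in [set s : {perm 'I_n} | (k < #|porbits s|)%N]) opt_event s.
Proof.
apply/seteqP; split=> w.
  by move=> /max_opt_cycles_gtP[s ks s_opt]; exists s.
by move=> [s ks s_opt]; apply/max_opt_cycles_gtP; exists s.
Qed.

Lemma measurable_many_cycles n k : measurable (many_cycles n k).
Proof.
rewrite many_cyclesE; apply: fin_bigcup_measurable => [|s _].
  exact: finite_finset.
exact: (m_opt s).
Qed.

(* By Markov's inequality: [2 ^ #cycles] has mean at most [n + 1]. *)
Lemma prob_many_cycles_le n k :
  (P (many_cycles n k) <= (n.+1%:R / 2 ^+ k.+1)%:E)%E.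
Proof.
apply: (@le_trans _ _ (\sum_(s : {perm 'I_n} | (k < #|porbits s|)%N)
    P (opt_event s))%E).
  apply: measure_bigcup_fin_le => [|s|]; [|exact: m_opt|].
    exact: measurable_many_cycles.
  by rewrite many_cyclesE.
apply: (@le_trans _ _ (\sum_(s : {perm 'I_n})
    ((2 ^ #|porbits s|)%:R / (2 ^+ k.+1 * n`!%:R))%:E)%E).
  rewrite big_mkcond; apply: lee_sum => s _; case: ifPn => ks; last first.
    by rewrite lee_fin divr_ge0// mulr_ge0// exprn_ge0.
  apply: (le_trans (prob_opt_matching_le s)); rewrite lee_fin invfM mulrA.
  rewrite ler_peMl ?invr_ge0// ler_pdivlMr ?exprn_gt0// mul1r.
  by rewrite natrX ler_weXn2l// ler1n.
rewrite sumEFin lee_fin -mulr_suml -natr_sum sum_exp2_porbits card_ord factS.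
by rewrite natrM -mulf_div divff ?mulr1// pnatr_eq0 -lt0n fact_gt0.
Qed.

Lemma ae_max_opt_cycles_le : {ae P, forall w, \forall n \near \oo,
  (max_opt_cycles n (X^~ w) (Y^~ w) <= trunc_log 2 (n.+2 ^ 3))%N}.
Proof.
have : {ae P, forall w, \forall n \near \oo,
    ~ many_cycles n (trunc_log 2 (n.+2 ^ 3)) w}.
  apply: (borel_cantelli _ _ is_cvg_series_succ_div_cube) => n.
    exact: measurable_many_cycles.
  apply: le_trans (prob_many_cycles_le _ _) _; rewrite lee_fin.
  rewrite ler_wpM2l// lef_pV2 ?posrE ?exprn_gt0// -!natrX ler_nat ltnW//.
  exact: trunc_log_ltn.
by apply: filterS => w; apply: filterS => n /negP; rewrite -leqNgt.
Qed.

Lemma ae_max_opt_cycles_sublinear : {ae P, forall w,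
  (max_opt_cycles n (X^~ w) (Y^~ w))%:R / n%:R @[n --> \oo] --> (0 : R)}.
Proof.
have cvg_bound :
    3 * ((trunc_log 2 (n.+2 ^ 3))%:R / n.+2%:R) @[n --> \oo] --> (0 : R).
  rewrite -(mulr0 3); apply: cvgMr.
  by have := @cvg_trunc_logX_div R 2 3 isT; rewrite -2!cvg_shiftS.
apply: filterS ae_max_opt_cycles_le => w cycles_le.
apply: squeeze_cvgr (cvg_cst 0) cvg_bound; near=> n.
have n0 : (0 < n)%N by near: n; exact: nbhs_infty_gt.
rewrite divr_ge0//= mulrCA ler_pM//; first by rewrite ler_nat; near: n.
rewrite ler_pdivlMr ?ltr0n// ler_pdivrMl ?ltr0n// -natrM ler_nat; lia.
Unshelve. all: by end_near.
Qed.

Let dist (i : nat) (w : T) : R := edist (X i w) (Y i w).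

Let pair_block (i : nat) : seq (nat + nat) := [:: inl i; inr i].

Lemma uniq_flatten_pair_block (r : seq nat) :
  uniq r -> uniq (flatten [seq pair_block i | i <- r]).
Proof.
elim: r => [//|i r IH] /= /andP[ir /IH ->]; rewrite !inE andbT /=.
by apply/andP; split; apply: contra ir => /flatten_mapP[j jr];
   rewrite !inE => /orP[]/eqP// [->].
Qed.

Lemma dist_sublevel_sigma_pair e i :
  <<s cylinders Z (pair_block i) >> [set w | dist i w <= e].
Proof.
apply: (@measurable_set_ler _ _
  (g_sigma_algebraType (cylinders Z (pair_block i)))).
  apply: measurable_fun_edist.
  - by apply: (@measurable_coord _ _ _ _ Z _ (inl i)); rewrite !inE eqxx.
  - by apply: (@measurable_coord _ _ _ _ Z _ (inr i)); rewrite !inE eqxx orbT.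
exact: measurable_cst.
Qed.

Lemma eq_prob_dist_sublevel e i :
  P [set w | dist i w <= e] = P [set w | dist 0 w <= e].
Proof.
pose shift (k : nat + nat) : nat + nat :=
  match k with inl _ => inl i | inr _ => inr i end.
pose unshift (k : nat + nat) : nat + nat :=
  match k with inl _ => inl 0%N | inr _ => inr 0%N end.
have shiftK : {in pair_block 0, cancel shift unshift}.
  by move=> k; rewrite !inE => /orP[]/eqP ->.
pose B := [set h : nat + nat -> d.-tuple R |
  edist (h (inl 0%N)) (h (inr 0%N)) <= e].
have mB : <<s cylinders coordinate (pair_block 0) >> B.
  apply: (@measurable_set_ler _ _
    (g_sigma_algebraType (cylinders (@coordinate _ (d.-tuple R) _) _))).
    apply: measurable_fun_edist.
    - exact: (@measurable_coord _ _ _ _ coordinate _ (inl 0%N)).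
    - exact: (@measurable_coord _ _ _ _ coordinate _ (inr 0%N)).
  exact: measurable_cst.
by apply: (eq_law_reindex hZ indepZ _ shiftK _ mB) => // -[].
Qed.

Lemma ae_sum_dist_linear_growth : exists2 c, 0 < c &
  {ae P, forall w, \forall n \near \oo,
    c * n%:R <= \sum_(i < n) edist (X i w) (Y i w)}.
Proof.
apply: (@ae_sum_linear_growth _ _ _ P dist).
- by move=> i; exact: measurable_fun_edist.
- by move=> i w; exact: edist_ge0.
- move=> e r ur.
  apply: (indep_blocks _ indepZ (uniq_flatten_pair_block ur)) => i.
    exact: has_density_measurable (hZ i).
  exact: dist_sublevel_sigma_pair.
- exact: eq_prob_dist_sublevel.
- have := @negligible_coincidence _ _ _ _ _ _ _ _ hZ indepZ (inl 0%N) (inr 0%N).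
  move=> /(_ (ltnW d_ge2) isT)/(negligibleS _) null.
  apply: measure_negligible; last first.
    by apply: null => w /=; rewrite le_eqVlt ltNge edist_ge0 orbF => /eqP.
  by apply: measurable_set_ler => //; exact: measurable_fun_edist.
Qed.

End PickupsAndDeliveries.

(** * The limit *)

Lemma cvg_div1_of_sublinear_error {R : realType} (a b e : nat -> R) (c C : R) :
    0 < c -> (\forall n \near \oo, c * n%:R <= b n) ->
    (forall n, `|a n - b n| <= C * e n) ->
    e n / n%:R @[n --> \oo] --> (0 : R) ->
  a n / b n @[n --> \oo] --> (1 : R).
Proof.
move=> c0 b_ge ab_le e_o; apply/cvgrPdist_le => eps eps0.
have {}e_o : C * (e n / n%:R) @[n --> \oo] --> (0 : R).
  by rewrite -(mulr0 C); apply: cvgMr.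
near=> n.
have n0 : 0 < n%:R :> R by rewrite ltr0n; near: n; exact: nbhs_infty_gt.
have bn : c * n%:R <= b n by near: n.
have b0 : 0 < b n by rewrite (lt_le_trans _ bn)// mulr_gt0.
have -> : 1 - a n / b n = (b n - a n) / b n by rewrite mulrBl divff// gt_eqF.
rewrite normrM normfV (gtr0_norm b0) ler_pdivrMr// distrC.
rewrite (le_trans (ab_le n))//.
apply: (@le_trans _ _ (eps * (c * n%:R))); last by rewrite ler_pM2l.
rewrite mulrA -ler_pdivrMr// -mulrA (le_trans (ler_norm _))//; near: n.
by apply: cvgr0_norm_le => //; rewrite mulr_gt0.
Unshelve. all: by end_near.
Qed.

Lemma compact_edist_bounded {R : realType} (d : nat)
    (Omega : set (d.-tuple R)) :
    compact (@tuple_row R d @` Omega) ->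
  exists2 D : R, 0 <= D & forall a b, Omega a -> Omega b -> edist a b <= D.
Proof.
move=> /compact_bounded[M [_ normM]]; pose K := M + 1.
have coord_le t i : Omega t -> `|tnth t i| <= K.
  move=> Ot; have MK : M < K by rewrite ltrDl.
  have /= := normM K MK (tuple_row t) (ex_intro2 _ _ t Ot erefl).
  rewrite [`|tuple_row t|]mx_normrE => /(le_trans _); apply.
  have := le_bigmax 0 (fun ij => `|tuple_row t ij.1 ij.2|) (ord0, i).
  by rewrite /= mxE.
exists (Num.sqrt (\sum_(i < d) (2 * K) ^+ 2)); first exact: sqrtr_ge0.
move=> a b Oa Ob; apply: ler_wsqrtr; apply: ler_sum => i _.
rewrite -[leLHS]real_normK ?num_real//.
have K0 : 0 <= K by apply: le_trans (coord_le a i Oa).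
rewrite ler_pXn2r// ?nnegrE ?mulr_ge0//.
rewrite (le_trans (ler_normB _ _))// mulr_natl mulr2n.
by rewrite lerD ?coord_le.
Qed.

Unset Implicit Arguments.

Theorem theorem1 (R : realType) (d : nat) (hd : (2 <= d)%N)
  (Omega : set (d.-tuple R)) (hOmega : compact (@tuple_row R d @` Omega))
  (d0 : measure_display) (T : measurableType d0) (P : probability T R)
  (X Y : nat -> T -> d.-tuple R) (phiP phiD : d.-tuple R -> R)
  (hX : forall i, has_density P (X i) phiP)
  (hY : forall i, has_density P (Y i) phiD)
  (hXO : forall i, {ae P, forall w, Omega (X i w)})
  (hYO : forall i, {ae P, forall w, Omega (Y i w)})
  (hind : mutually_independent P
            (fun k : nat + nat => match k with inl i => X i | inr i => Y i end))
  (Lopt Lspl : nat -> T -> R)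
  (hLopt : forall n w, is_opt_tour_len n (X^~ w) (Y^~ w) (Lopt n w))
  (hLspl : forall n w, is_splice_len n (X^~ w) (Y^~ w) (Lspl n w)) :
  {ae P, forall w, (Lspl n w / Lopt n w) @[n --> \oo] --> (1 : R)}.
Proof.
have [D D0 dist_le] := compact_edist_bounded hOmega.
have [c c0 growth] := ae_sum_dist_linear_growth hd hX hY hind.
have few_cycles := ae_max_opt_cycles_sublinear hd hX hY hind.
have aeP : Filter (almost_everywhere P) by exact: ae_filter_ringOfSetsType.
apply: filterS3 (filterI (ae_foralln hXO) (ae_foralln hYO)) growth few_cycles.
move=> w [Xw Yw] growth_w few_cycles_w.
have xyD i j : edist (X i w) (Y j w) <= D by exact: dist_le.
apply: (cvg_div1_of_sublinear_error c0 _ _ few_cycles_w) => [|n].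
  apply: filterS growth_w => n /le_trans; apply.
  exact: opt_tour_len_ge (hLopt n w).
exact: splice_opt_dist D0 _ (hLopt n w) (hLspl n w).
Qed.
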